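(* Let $H$ be a separable infinite-dimensional complex Hilbert space, let $I$ be the identity operator on $H$, and let $K$ be a non-negative (self-adjoint) compact operator on $H$ of infinite rank. Then $I-K$ is not a real linear combination of three orthoprojections, i.e. there do not exist real numbers $\beta_1,\beta_2,\beta_3$ and orthoprojections $Q_1,Q_2,Q_3$ on $H$ with $I-K=\beta_1Q_1+\beta_2Q_2+\beta_3Q_3$.
   Context: An orthoprojection on $H$ is a bounded operator $P$ on $H$ with $P=P^*=P^2$. Non-negative means $(Kx,x)\ge 0$ for all $x\in H$. *)

(* Defs.v *)
From HB Require Import structures.
From mathcomp Require Import all_boot all_order all_algebra.
From mathcomp Require Import complex.
From mathcomp Require Import all_classical all_reals all_analysis.

Set Implicit Arguments.
Unset Strict Implicit.
Unset Printing Implicit Defensive.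

Import Order.TTheory GRing.Theory Num.Theory.
Import numFieldNormedType.Exports.

Local Open Scope classical_set_scope.
Local Open Scope ring_scope.
Local Open Scope complex_scope.

(* A complex Hilbert space is a complete normed module [H] over [R[i]] with a
   positive definite Hermitian form [ip], linear in the first argument and
   conjugate-linear in the second, such that [norm_from_inner ip]. *)
Definition norm_from_inner (R : realType) (H : completeNormedModType R[i])
    (ip : {dot H for (@Num.conj R[i])}) : Prop :=
  forall x : H, `|x| ^+ 2 = ip x x.

Definition separable (T : topologicalType) : Prop :=
  exists2 D : set T, countable D & dense D.

(* [A] is the linear span of finitely many vectors. *)
Definition finite_dimensional (F : fieldType) (V : lmodType F) (A : set V) :
    Prop :=
  exists (n : nat) (e : 'I_n -> V),
    A = [set \sum_(i < n) c i *: e i | c in [set: 'I_n -> F]].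

Section operators.
Variables (R : realType) (H : completeNormedModType R[i]).
Variable ip : {dot H for (@Num.conj R[i])}.

Definition bounded_operator (T : {linear H -> H}) : Prop :=
  exists M : R, forall x : H, `|T x| <= M%:C * `|x|.

Definition is_adjoint (T S : {linear H -> H}) : Prop :=
  forall x y : H, ip (T x) y = ip x (S y).

Definition self_adjoint (T : {linear H -> H}) : Prop := is_adjoint T T.

(* The order of [R[i]] makes this say that [ip (T x) x] is real and
   non-negative. *)
Definition nonnegative_operator (T : {linear H -> H}) : Prop :=
  forall x : H, 0 <= ip (T x) x.

Definition compact_operator (T : {linear H -> H}) : Prop :=
  forall A : set H, bounded_set A -> precompact (T @` A).

Definition infinite_rank (T : {linear H -> H}) : Prop :=
  ~ finite_dimensional (range T).

Definition orthoprojection (P : {linear H -> H}) : Prop :=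
  [/\ bounded_operator P, self_adjoint P & forall x : H, P (P x) = P x].

End operators.

(* Main.v *)
From HB Require Import structures.
Require Import Defs.
From mathcomp Require Import all_boot all_order all_algebra finmap.
From mathcomp Require Import complex.
From mathcomp Require Import ring lra.
From mathcomp Require Import all_classical all_reals all_analysis.
Set Implicit Arguments.
Unset Strict Implicit.
Unset Printing Implicit Defensive.
Import Order.TTheory GRing.Theory Num.Theory.
Import numFieldNormedType.Exports.
Local Open Scope classical_set_scope.
Local Open Scope ring_scope.
Local Open Scope complex_scope.

(** If every coefficient is at most [0] then [I - K <= 0], so [K >= I]; a
    compact operator can dominate the identity only in finite dimension
    ([finite_rank_of_coercive]).  Otherwise, after renumbering, [b3 > 0], and
    one studies the spectrum of

      [M = K + b3 Q3 = I - b1 Q1 - b2 Q2]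

    through its two expressions.

    As a compact non-negative perturbation of [b3 Q3], [M] has spectrum that
    accumulates only at [0] and [b3], and only from above: [M >= 0]
    ([eigenvalue_ge0]); and for every [e > 0] only finitely many eigenvalues lie
    in [(e, b3)] or above [b3 + e] ([finite_eigenvalues_gap],
    [finite_eigenvalues_above]).  The reason for the gap is that, up to a
    condition of finite codimension, [M >= b3] on the range of [Q3] and
    [M <= e] on its kernel.  Moreover, when [K] has infinite rank, [M] does have
    eigenvalues other than [0] and [b3] that come arbitrarily close to these two
    points ([small_eigenvalues]): [M^2 - b3 M] is compact and self-adjoint, its
    eigenvectors produce eigenvectors of [M], and it cannot vanish on a
    subspace of finite codimension.

    As the identity minus a combination of two projections, [M] has spectrum
    symmetric about [(2 - b1 - b2) / 2], apart from five exceptional values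
    ([reflected_eigenvalue]).

    The two descriptions are incompatible.  With [r = 2 - b1 - b2], for every
    small [e > 0] there is an eigenvalue [a], different from [0] and [b3], such
    that [a] and [r - a] both lie within [e] above [0] or [b3].  Their sum [r] is
    then strictly larger than one of [0], [b3], [2 b3], by at most [2 e]; for a
    fixed number [r] this fails once [e] is small enough.

    Only real eigenvalues occur, so everything is done in a real vector space
    with an inner product.  The complex space enters at the end, through its
    underlying real space with the real part of its inner product
    ([realification]). *)

(** * Real inner products *)

Section InnerProduct.
Variables (R : realType) (V : lmodType R) (ip : {dot V for @idfun R}).
Local Notation "''[' u , v ]" := (ip u%R v%R) : ring_scope.
Local Notation "''[' u ]" := '[u, u] : ring_scope.
Implicit Types (x y z : V) (a : R) (L : seq V).

Lemma ipC x y : '[x, y] = '[y, x].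
Proof. by rewrite hermC expr0 mul1r. Qed.

Lemma ipDl x y z : '[x + y, z] = '[x, z] + '[y, z].
Proof. exact: linearDl. Qed.

Lemma ipDr x y z : '[z, x + y] = '[z, x] + '[z, y].
Proof. exact: linearDr. Qed.

Lemma ipNl x z : '[- x, z] = - '[x, z].
Proof. exact: linearNl. Qed.

Lemma ipNr x z : '[z, - x] = - '[z, x].
Proof. exact: linearNr. Qed.

Lemma ipZl a x z : '[a *: x, z] = a * '[x, z].
Proof. exact: linearZl_LR. Qed.

Lemma ipZr a x z : '[z, a *: x] = a * '[z, x].
Proof. exact: (linearZr_LR _ _ a). Qed.

Lemma ip0l z : '[0, z] = 0.
Proof. exact: linear0l. Qed.

Lemma ip0r z : '[z, 0] = 0.
Proof. exact: linear0r. Qed.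

Lemma ip_suml I (r : seq I) (F : I -> V) z :
  '[\sum_(i <- r) F i, z] = \sum_(i <- r) '[F i, z].
Proof. exact: linear_sumlz. Qed.

Lemma ip_sumr I (r : seq I) (F : I -> V) z :
  '[z, \sum_(i <- r) F i] = \sum_(i <- r) '[z, F i].
Proof. exact: linear_sumr. Qed.

Lemma sq_gt0 x : (0 < '[x]) = (x != 0).
Proof.
have [->|x0] := eqVneq x 0; first by rewrite ip0l ltxx.
exact: neq0_dnorm_gt0.
Qed.

Lemma sq_ge0 x : 0 <= '[x].
Proof.
by have [->|] := eqVneq x 0; rewrite ?ip0l // -sq_gt0 => /ltW.
Qed.

Lemma sq_eq0 x : ('[x] == 0) = (x == 0).
Proof. by apply/negb_inj; rewrite -sq_gt0 lt0r sq_ge0 andbT. Qed.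

Lemma ip_CauchySchwarz x y : '[x, y] ^+ 2 <= '[x] * '[y].
Proof.
have [->|y0] := eqVneq y 0; first by rewrite !ip0r expr0n mulr0.
have y1 : 0 < '[y] by rewrite sq_gt0.
have := sq_ge0 ('[y] *: x - '[x, y] *: y).
rewrite !(ipDl, ipDr, ipNl, ipNr, ipZl, ipZr) (ipC y x).
set a := '[x]; set b := '[x, y]; set c := '[y] => h.
rewrite -(ler_pM2l y1) -subr_ge0; apply: le_trans h _.
by rewrite le_eqVlt; apply/orP; left; apply/eqP; rewrite -/c; ring.
Qed.

Lemma sq_add_le x y : '[x + y] <= 2 * '[x] + 2 * '[y].
Proof.
have := sq_ge0 (x - y).
rewrite !(ipDl, ipDr, ipNl, ipNr) (ipC y x); lra.
Qed.

Lemma sq_sub_le x y : '[x - y] <= 2 * '[x] + 2 * '[y].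
Proof. by apply: le_trans (sq_add_le _ _) _; rewrite ipNl ipNr opprK. Qed.

Lemma exists_unit_scale x : x != 0 -> exists2 a, a != 0 & '[a *: x] = 1.
Proof.
rewrite -sq_gt0 => x0; exists (Num.sqrt '[x])^-1.
  by rewrite invr_neq0 // gt_eqF // sqrtr_gt0.
by rewrite ipZl ipZr mulrA -expr2 exprVn sqr_sqrtr ?ltW // mulVf // gt_eqF.
Qed.

End InnerProduct.

(** * Compact symmetric operators *)

Section Spectral.
Variables (R : realType) (V : lmodType R) (ip : {dot V for @idfun R}).
Local Notation "''[' u , v ]" := (ip u%R v%R) : ring_scope.
Local Notation "''[' u ]" := '[u, u] : ring_scope.
Implicit Types (x y z : V) (a : R) (L : seq V) (T : {linear V -> V}).

Lemma le0_of_le_small a c : (forall e, 0 < e -> a <= c * e) -> a <= 0.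
Proof.
move=> h; rewrite leNgt; apply/negP => a0.
have d0 : 0 < `|c| + 1 by rewrite ltr_wpDl.
have := h (a / (2 * (`|c| + 1))); rewrite divr_gt0 ?mulr_gt0 // => /(_ isT).
have -> : c * (a / (2 * (`|c| + 1))) = a * (c / (2 * (`|c| + 1))) by ring.
have : c / (2 * (`|c| + 1)) < 1.
  rewrite ltr_pdivrMr ?mulr_gt0 // mul1r; have := ler_norm c; lra.
by rewrite -(ltr_pM2l a0) mulr1 => /lt_geF ->.
Qed.

Definition symmetric_op T := forall x y, '[T x, y] = '[x, T y].

Definition eigenvector (f : V -> V) a x := x != 0 /\ f x = a *: x.

Definition orth L x := forall l, l \in L -> '[x, l] = 0.

Lemma orthD L x y : orth L x -> orth L y -> orth L (x + y).
Proof. by move=> hx hy l lL; rewrite ipDl hx // hy // addr0. Qed.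

Lemma orthZ L a x : orth L x -> orth L (a *: x).
Proof. by move=> hx l lL; rewrite ipZl hx // mulr0. Qed.

Lemma orth_cat L1 L2 x : orth (L1 ++ L2) x <-> orth L1 x /\ orth L2 x.
Proof.
split=> [h|[h1 h2] l]; last by rewrite mem_cat => /orP[/h1|/h2].
by split=> l lL; apply: h; rewrite mem_cat lL ?orbT.
Qed.

Lemma orth_map (f : V -> V) L x : (forall x y, '[f x, y] = '[x, f y]) ->
  orth (map f L) x -> orth L (f x).
Proof. by move=> fs h l lL; rewrite fs; apply: h; apply: map_f. Qed.

Lemma orth_eigen T L x : symmetric_op T ->
  (forall l, l \in L -> exists a, eigenvector T a l) ->
  orth L x -> orth L (T x).
Proof.
move=> Ts hL hx l lL; have [a [_ Tl]] := hL l lL.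
by rewrite Ts Tl ipZr hx // mulr0.
Qed.

Variables (U : set_system nat) (UF : ProperFilter U).
Hypothesis Uoo : forall N, U [set n | (N <= n)%N].

(** Convergence along one fixed filter replaces the extraction of
    subsequences, so that the compactness of a sum or a composite needs no
    diagonal argument.  When [U] is a free ultrafilter, [compact_along] is
    compactness in the usual sense. *)
Definition cvg_along (x : nat -> V) y :=
  forall e : R, 0 < e -> U [set n | '[x n - y] < e].

Definition compact_along (f : V -> V) := forall x : nat -> V,
  (exists M, forall n, '[x n] <= M) -> exists y, cvg_along (f \o x) y.

Lemma cvg_alongD (x1 x2 : nat -> V) y1 y2 :
  cvg_along x1 y1 -> cvg_along x2 y2 ->
  cvg_along (fun n => x1 n + x2 n) (y1 + y2).
Proof.
move=> h1 h2 e e0; have e4 : 0 < e / 4 by rewrite divr_gt0.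
apply: filterS (filterI (h1 _ e4) (h2 _ e4)) => n /= [a1 a2].
rewrite opprD addrACA; have := sq_add_le ip (x1 n - y1) (x2 n - y2); lra.
Qed.

Lemma small_invn (e : R) : 0 < e -> exists N, forall n, (N <= n)%N ->
  n.+1%:R^-1 < e.
Proof.
move=> e0; exists (Num.truncn e^-1) => n Nn.
rewrite invf_plt ?posrE //.
apply: lt_le_trans (truncnS_gt _) _; by rewrite ler_nat.
Qed.

(** Unit vectors [x n] with [T (x n)] of squared norm above [n] could not have
    convergent images. *)
Lemma compact_along_bounded T : compact_along T ->
  exists2 C, 0 <= C & forall x, '[T x] <= C * '[x].
Proof.
move=> cT; apply: contrapT => hn.
have /choice[x hx] : forall n : nat, exists x, '[x] = 1 /\ n%:R < '[T x].
  move=> n; apply: contrapT => hx; apply: hn; exists n%:R => // x.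
  have [->|x0] := eqVneq x 0; first by rewrite (linear0 T) !ip0l mulr0.
  have [a a0 ax1] := exists_unit_scale ip x0.
  rewrite leNgt; apply/negP => hlt; apply: hx; exists (a *: x); split=> //.
  rewrite [T (_ *: _)]linearZ; move: ax1; rewrite !(ipZl, ipZr) !mulrA -expr2 => ax1.
  have a2 : 0 < a ^+ 2 by rewrite exprn_even_gt0.
  have : a ^+ 2 * (n%:R * '[x]) < a ^+ 2 * '[T x] by rewrite ltr_pM2l.
  by rewrite mulrCA ax1 mulr1.
have [y hy] : exists y, cvg_along (T \o x) y.
  by apply: cT; exists 1 => n; have [-> _] := hx n.
have [N /= hN] : exists N : nat, 2 + 2 * '[y] < N%:R.
  by exists (Num.truncn (2 + 2 * '[y])).+1; exact: truncnS_gt.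
have [n [/= h1 h2]] := filter_ex (filterI (hy 1 ltr01) (Uoo N)).
have := sq_add_le ip (T (x n) - y) y; rewrite subrK.
have := (hx n).2; have : (N%:R : R) <= n%:R by rewrite ler_nat.
lra.
Qed.

(** Let [t] be the supremum of the squared norms of [T x] over the unit vectors
    [x] of the invariant subspace, and let [x n] be a maximising sequence.
    Expanding the square shows that [T (T (x n)) - t x n] tends to [0], so that
    the limit [y] of [T (x n)], which is nonzero since [t > 0], satisfies
    [T (T y) = t y].  Factoring [T^2 - t] then makes [y] or [T y + sqrt t y] an
    eigenvector, for the eigenvalue [- sqrt t] or [sqrt t]. *)
Lemma exists_eigenvector T L (e : R) x0 :
    symmetric_op T -> compact_along T ->
    (forall x, orth L x -> orth L (T x)) ->
    0 <= e -> orth L x0 -> e * '[x0] < '[T x0] ->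
  exists a x, [/\ eigenvector T a x, orth L x & e < a ^+ 2].
Proof.
move=> Ts cT LT e0 Lx0 ex0.
have [C C0 hC] := compact_along_bounded cT.
have x0n : x0 != 0.
  by apply/eqP => x00; move: ex0; rewrite x00 (linear0 T) !ip0l mulr0 ltxx.
pose S := [set t | exists x, [/\ orth L x, '[x] = 1 & t = '[T x]]].
have unitS x : orth L x -> x != 0 -> S ('[T x] / '[x]).
  move=> Lx xn; have [a a0 ax1] := exists_unit_scale ip xn; exists (a *: x).
  split=> //; first exact: orthZ.
  move: ax1; rewrite [T (_ *: _)]linearZ !(ipZl, ipZr) !mulrA => ax1.
  have xx : '[x] != 0 by rewrite sq_eq0.
  by apply: (mulIf xx); rewrite divfK // mulrAC ax1 mul1r.
have supS : has_sup S.
  split; first by exists ('[T x0] / '[x0]); exact: unitS.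
  by exists C => _ [x [_ x1 ->]]; have := hC x; rewrite x1 mulr1.
pose t := sup S.
have tub x : orth L x -> '[T x] <= t * '[x].
  move=> Lx; have [->|xn] := eqVneq x 0; first by rewrite (linear0 T) !ip0l mulr0.
  rewrite -ler_pdivrMr ?sq_gt0 //; apply: sup_upper_bound => //.
  exact: unitS.
have et : e < t.
  rewrite -(ltr_pM2r (_ : 0 < '[x0])) ?sq_gt0 //.
  exact: lt_le_trans ex0 (tub _ Lx0).
have t0 : 0 < t by exact: le_lt_trans et.
have /choice[x hx] : forall n : nat, exists x,
    [/\ orth L x, '[x] = 1 & t - n.+1%:R^-1 < '[T x]].
  move=> n; have n0 : 0 < n.+1%:R^-1 :> R by rewrite invr_gt0.
  by have [_ [x [h1 h2 ->]] h3] := sup_adherent n0 supS; exists x.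
have [y hy] : exists y, cvg_along (T \o x) y.
  by apply: cT; exists 1 => n; have [_ -> _] := hx n.
have near_y d : 0 < d -> exists n, '[T (x n) - y] < d /\ t - d < '[T (x n)].
  move=> d0; have [N hN] := small_invn d0.
  have [n [/= h1 h2]] := filter_ex (filterI (hy d d0) (Uoo N)).
  exists n; split=> //; have [_ _] := hx n; apply: lt_trans.
  by rewrite ltrD2l ltrN2 hN.
have Ly : orth L y.
  move=> l lL; apply/eqP; rewrite -sqrf_eq0 eq_le sqr_ge0 andbT.
  apply: (@le0_of_le_small _ '[l]) => d d0; have [n [h1 _]] := near_y d d0.
  have [Lx _ _] := hx n.
  have -> : '[y, l] ^+ 2 = '[T (x n) - y, l] ^+ 2.
    by rewrite ipDl ipNl (LT _ Lx) // add0r sqrrN.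
  apply: le_trans (ip_CauchySchwarz _ _ _) _; rewrite mulrC.
  by apply: ler_wpM2l; rewrite ?sq_ge0 // ltW.
have yn : y != 0.
  apply/eqP => y0; have t2 : 0 < t / 2 by rewrite divr_gt0.
  have [n []] := near_y _ t2; rewrite y0 subr0; lra.
have TTy : T (T y) = t *: y.
  apply/eqP; rewrite -subr_eq0 -(sq_eq0 ip) eq_le sq_ge0 andbT.
  apply: (@le0_of_le_small _ (4 * C ^+ 2 + 4 * t ^+ 2 + 2 * (C * t))) => d d0.
  have [n [h1 h2]] := near_y d d0; have [Lx x1 _] := hx n.
  set z := T (x n) in h1 h2 *.
  have zE : '[T z - t *: x n] <= t * d.
    have h := tub z (LT _ Lx).
    have zx : '[T z, x n] = '[z] by rewrite Ts.
    rewrite !(ipDl, ipDr, ipNl, ipNr, ipZl, ipZr) x1 (ipC ip (x n)) zx.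
    have : 0 <= t * (d - t + '[z]) by apply: mulr_ge0; lra.
    lra.
  have -> : T (T y) - t *: y =
      (T (T (y - z)) - t *: (y - z)) + T (T z - t *: x n).
    have aux (u v w s : V) : u - v - (w - s) + (v - s) = u - w.
      by rewrite opprB -addrA (addrC (s - w)) !addrA subrK subrK.
    rewrite !(linearB T) (linearZ_LR T) -/z scalerBr; apply/esym; exact: aux.
  apply: le_trans (sq_add_le _ _ _) _.
  have h3 : '[y - z] <= d by rewrite -opprB ipNl ipNr opprK ltW.
  have h4 : '[T (T (y - z)) - t *: (y - z)] <= (2 * C ^+ 2 + 2 * t ^+ 2) * d.
    apply: le_trans (sq_sub_le _ _ _) _; rewrite ipZl ipZr.
    have h5 := hC (T (y - z)); have h6 := hC (y - z).
    have h7 : C * '[T (y - z)] <= C * (C * d).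
      by apply: ler_wpM2l => //; apply: le_trans h6 _; apply: ler_wpM2l.
    have h8 : t * (t * '[y - z]) <= t * (t * d).
      by rewrite !ler_pM2l.
    lra.
  have h5 : '[T (T z - t *: x n)] <= C * (t * d).
    by apply: le_trans (hC _) _; apply: ler_wpM2l.
  lra.
have s0 : 0 < Num.sqrt t by rewrite sqrtr_gt0.
have s2 : Num.sqrt t ^+ 2 = t by rewrite sqr_sqrtr // ltW.
have [w0|wn] := eqVneq (T y + Num.sqrt t *: y) 0.
  exists (- Num.sqrt t), y; rewrite sqrrN s2; split=> //; split=> //.
  by apply/eqP; rewrite scaleNr -addr_eq0 w0.
exists (Num.sqrt t), (T y + Num.sqrt t *: y); rewrite s2; split=> //.
  by split=> //; rewrite linearD linearZ /= TTy scalerDr scalerA -expr2 s2 addrC.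
by apply: orthD; [exact: LT|exact: orthZ].
Qed.

(** Otherwise unit eigenvectors with squared eigenvalue above [e] can be chosen
    one after the other, each orthogonal to all the previous ones.  Their images
    are at squared distance more than [2 e] from one another, which compactness
    forbids. *)
Lemma eigenvectors_off_small T (e : R) :
    symmetric_op T -> compact_along T -> 0 < e ->
  exists L, (forall l, l \in L -> exists a, eigenvector T a l) /\
            forall x, orth L x -> '[T x] <= e * '[x].
Proof.
move=> Ts cT e0; apply: contrapT => hn.
pose good L := forall l, l \in L -> exists a, eigenvector T a l.
have /choice[f hf] : forall L, exists x, good L ->
    [/\ '[x] = 1, orth L x & exists2 a, eigenvector T a x & e < a ^+ 2].
  move=> L; have [gL|] := pselect (good L); last by exists 0.
  have [x0 Lx0 ex0] : exists2 x, orth L x & e * '[x] < '[T x].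
    apply: contrapT => h; apply: hn; exists L; split=> // x Lx.
    by rewrite leNgt; apply/negP => ex; apply: h; exists x.
  have [a [x [[xn Tx] Lx ea]]] :=
    exists_eigenvector Ts cT (fun x => orth_eigen Ts gL) (ltW e0) Lx0 ex0.
  have [b b0 bx1] := exists_unit_scale ip xn; exists (b *: x) => _; split=> //.
    exact: orthZ.
  exists a => //; split; first by rewrite scaler_eq0 (negPf b0).
  by rewrite linearZ /= Tx !scalerA mulrC.
pose F n := iter n (fun L => f L :: L) [::].
have gF n : good (F n).
  elim: n => [|n IH] l //=; rewrite inE => /orP[/eqP ->|]; last exact: IH.
  by have [_ _ [a]] := hf _ IH; exists a.
have inF m n : (m < n)%N -> f (F m) \in F n.
  elim: n => // n IH; rewrite ltnS leq_eqVlt inE => /orP[/eqP ->|/IH ->].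
    by rewrite eqxx.
  by rewrite orbT.
have [y hy] : exists y, cvg_along (T \o (f \o F)) y.
  by apply: cT; exists 1 => n /=; have [-> _ _] := hf _ (gF n).
have e2 : 0 < e / 2 by rewrite divr_gt0.
have [m /= hm] := filter_ex (hy _ e2).
have [n [/= hn' mn]] := filter_ex (filterI (hy _ e2) (Uoo m.+1)).
have [m1 _ [a [_ Tm] ea]] := hf _ (gF m).
have [n1 nL [b [_ Tn] eb]] := hf _ (gF n).
have := sq_sub_le ip (T (f (F n)) - y) (T (f (F m)) - y).
rewrite opprB addrA subrK.
have -> : '[T (f (F n)) - T (f (F m))] = a ^+ 2 + b ^+ 2.
  rewrite Tm Tn !(ipDl, ipDr, ipNl, ipNr, ipZl, ipZr) m1 n1.
  by rewrite (ipC ip (f (F m))) (nL _ (inF _ _ mn)); ring.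
lra.
Qed.

End Spectral.

(** * Subspaces of finite codimension *)

Section FiniteCodimension.
Variables (R : realType) (V : lmodType R) (ip : {dot V for @idfun R}).
Local Notation "''[' u , v ]" := (ip u%R v%R) : ring_scope.
Local Notation "''[' u ]" := '[u, u] : ring_scope.
Implicit Types (x y z : V) (a : R) (L : seq V) (T : {linear V -> V}).

(** The spanning vectors are taken in the range of [f], so that they span it
    over any larger field of scalars as well. *)
Definition finite_rank (f : V -> V) := exists s : seq V, forall x,
  exists c : nat -> R, f x = \sum_(i < size s) c i *: f s`_i.

(** By induction on [L]: a further orthogonality condition either holds already
    on the subspace at hand, or is met after subtracting a multiple of a single
    vector [w]. *)
Lemma orth_cofinite L : exists s : seq V, forall x,
  exists c : nat -> R, orth ip L (x - \sum_(i < size s) c i *: s`_i).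
Proof.
elim: L => [|l L [s hs]]; first by exists [::] => x; exists (fun=> 0).
have [[w Lw wl]|h] := pselect (exists2 w, orth ip L w & '[w, l] != 0).
  exists (w :: s) => x; have [c hc] := hs x.
  set x' := (X in orth _ _ X) in hc.
  pose d := '[x', l] / '[w, l].
  exists (fun i => if i is j.+1 then c j else d) => l'.
  rewrite big_ord_recl /= opprD addrCA -/x' addrC -scaleNr ipDl ipZl inE.
  case/orP => [/eqP ->|l'L]; first by rewrite mulNr divfK // subrr.
  by rewrite hc // Lw // mulr0 addr0.
exists s => x; have [c hc] := hs x; exists c => l'; rewrite inE.
case/orP => [/eqP ->|]; last exact: hc.
apply/eqP/negPn/negP => n0; apply: h.
by exists (x - \sum_(i < size s) c i *: s`_i).
Qed.

Lemma finite_rank_of_orth T L :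
  (forall x, orth ip L x -> T x = 0) -> finite_rank T.
Proof.
move=> h; have [s hs] := orth_cofinite L; exists s => x.
have [c hc] := hs x; exists c.
have /eqP := h _ hc; rewrite linearB subr_eq0 => /eqP ->.
by rewrite linear_sum; apply: eq_bigr => i _; rewrite linearZ.
Qed.

Lemma eigenvector_orth T a b x y : symmetric_op ip T -> a != b ->
  eigenvector T a x -> eigenvector T b y -> '[x, y] = 0.
Proof.
move=> Ts ab [_ Tx] [_ Ty]; have := Ts x y.
rewrite Tx Ty ipZl ipZr => /eqP; rewrite -subr_eq0 -mulrBl mulf_eq0 subr_eq0.
by rewrite (negPf ab) => /eqP.
Qed.

(** More than [size L] eigenvectors have a nonzero combination [z] orthogonal to
    [L].  Eigenvectors for distinct eigenvalues being orthogonal, the form of [G]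
    at [z] is a sum of squares with the positive weights [g a]. *)
Lemma finite_positive_eigenvalues T (G : {linear V -> V}) (g : R -> R) L :
    symmetric_op ip T ->
    (forall a x, T x = a *: x -> G x = g a *: x) ->
    (forall x, orth ip L x -> '[G x, x] <= 0) ->
  finite_set [set a | (exists x, eigenvector T a x) /\ 0 < g a].
Proof.
move=> Ts Gg Gneg; apply: contrapT => /(infinite_set_fset (size L).+1).
case=> B BE nB; pose s := enum_fset B.
have us : uniq s by exact: fset_uniq.
have /choice[x hx] : forall a, exists x, a \in s -> eigenvector T a x /\ 0 < g a.
  move=> a; have [/BE[[x hx] ga]|na] := boolP (a \in B); first by exists x.
  by exists 0 => aB; case/negP: na.
pose e (j : 'I_(size s)) := x s`_j.
have he (j : 'I_(size s)) : eigenvector T s`_j (e j) /\ 0 < g s`_j.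
  by apply: hx; rewrite mem_nth.
have ee (j k : 'I_(size s)) : j != k -> '[e j, e k] = 0.
  move=> jk; apply: eigenvector_orth Ts _ (he j).1 (he k).1.
  by rewrite nth_uniq.
pose A := \matrix_(j < size s, i < size L) '[e j, L`_i].
have /rowV0Pn[v /sub_kermxP vA vn] : kermx A != 0.
  rewrite kermx_eq0; apply/negP => /eqP rA.
  by have := rank_leq_col A; rewrite rA leqNgt => /negP; apply; exact: nB.
pose z := \sum_j v 0 j *: e j.
have zL : orth ip L z.
  move=> l lL; have il : (index l L < size L)%N by rewrite index_mem.
  have := congr1 (fun W : 'rV_(size L) => W 0 (Ordinal il)) vA.
  rewrite !mxE => vA0; rewrite -[RHS]vA0 ip_suml; apply: eq_bigr => j _.
  by rewrite ipZl mxE /= nth_index.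
have := Gneg z zL; rewrite leNgt => /negP; apply.
have -> : '[G z, z] = \sum_j v 0 j ^+ 2 * (g s`_j * '[e j]).
  rewrite [G z]linear_sum ip_suml; apply: eq_bigr => j _.
  rewrite [G _]linearZ /= (Gg _ _ (he j).1.2) !ipZl ip_sumr (bigD1 j) //= big1.
    by rewrite ipZr; ring.
  by move=> k kj; rewrite ipZr ee ?mulr0 // eq_sym.
have h0 (j : 'I_(size s)) : 0 < g s`_j * '[e j].
  by rewrite mulr_gt0 ?(he j).2 // sq_gt0 (he j).1.1.
have /existsP[j vj] : [exists j, v 0 j != 0].
  apply: contraNT vn; rewrite negb_exists => /forallP h.
  by apply/eqP/rowP => j; rewrite mxE; apply/eqP/negPn.
rewrite (bigD1 j) //= ltr_pwDl //; first by rewrite mulr_gt0 // exprn_even_gt0.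
by apply: sumr_ge0 => k _; rewrite mulr_ge0 ?sqr_ge0 // ltW.
Qed.

End FiniteCodimension.

(** * Non-negative compact perturbations of a projection *)

Section Perturbation.
Variables (R : realType) (V : lmodType R) (ip : {dot V for @idfun R}).
Local Notation "''[' u , v ]" := (ip u%R v%R) : ring_scope.
Local Notation "''[' u ]" := '[u, u] : ring_scope.
Implicit Types (x y z : V) (a : R) (L : seq V) (T : {linear V -> V}).

(** Expand the square of [T x - k x]. *)
Lemma form_le_of_sq_le T k x : 0 < k -> '[T x] <= k ^+ 2 * '[x] ->
  '[T x, x] <= k * '[x].
Proof.
move=> k0 h; have := sq_ge0 ip (T x - k *: x).
rewrite !(ipDl, ipDr, ipNl, ipNr, ipZl, ipZr) (ipC ip x (T x)) => h'.
rewrite -(ler_pM2l k0); lra.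
Qed.

Variables (U : set_system nat) (UF : ProperFilter U).
Hypothesis Uoo : forall N, U [set n | (N <= n)%N].

Variables (K Q : {linear V -> V}) (b : R).
Hypotheses (Ks : symmetric_op ip K) (Qs : symmetric_op ip Q).
Hypotheses (Kpos : forall x, 0 <= '[K x, x]) (QQ : forall x, Q (Q x) = Q x).
Hypotheses (cK : compact_along ip U K) (b0 : 0 < b).

Variable M : {linear V -> V}.
Hypothesis ME : forall x, M x = K x + b *: Q x.

(** Expand the form of [K], which is non-negative, at [k x - K x]. *)
Lemma sq_le_nonnegative_form k x : 0 < k -> '[K (K x)] <= k ^+ 2 * '[K x] ->
  '[K x] <= k * '[K x, x].
Proof.
move=> k0 h; have := form_le_of_sq_le k0 h => {}h.
have := Kpos (k *: x - K x); rewrite [K (_ - _)]linearB [K (_ *: _)]linearZ /=.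
rewrite !(ipDl, ipDr, ipNl, ipNr, ipZl, ipZr) (Ks (K x) x) => h'.
rewrite -(ler_pM2l k0); lra.
Qed.

Lemma proj_orth x : '[Q x, x - Q x] = 0.
Proof. by rewrite Qs linearB /= QQ subrr ip0r. Qed.

Lemma proj_form x : '[Q x, x] = '[Q x].
Proof. by rewrite -{1}QQ Qs. Qed.

Lemma proj_contract x : '[Q x] <= '[x].
Proof.
have := sq_ge0 ip (x - Q x).
by rewrite !(ipDl, ipDr, ipNl, ipNr) (ipC ip x) proj_form; lra.
Qed.

Lemma M_symmetric : symmetric_op ip M.
Proof. by move=> x y; rewrite !ME ipDl ipDr ipZl ipZr Ks Qs. Qed.

Lemma eigenvalue_ge0 a x : eigenvector M a x -> 0 <= a.
Proof.
move=> [xn Mx]; have x0 : 0 < '[x] by rewrite sq_gt0.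
rewrite -(pmulr_lge0 _ x0) -ipZl -Mx ME ipDl ipZl proj_form.
by rewrite addr_ge0 ?Kpos // mulr_ge0 ?sq_ge0 // ltW.
Qed.

Lemma K_small_cofinite k : 0 < k -> exists L,
  (forall l, l \in L -> exists a, eigenvector K a l) /\
  (forall x, orth ip L x -> '[K x] <= k ^+ 2 * '[x]).
Proof.
by move=> k0; apply: (eigenvectors_off_small UF) => //; rewrite exprn_gt0.
Qed.

(** Take [L] such that the form of [K] is at most [k] on its orthogonal, and let
    [x] be orthogonal to [L] and to its image under [Q]; then [u = Q x] and
    [v = x - u] are orthogonal to [L] too.  With [c] and [h] the centre and the
    half-length of the interval from [k] to [b], the form of [M - c] is at least
    [h] on [u] and at most [- h] on [v].  Pairing [(M - c) x] with the vector
    [u - v], which has the norm of [x], bounds its norm below by that of [h x];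
    this says that the form of [(M - k) (M - b)] at [x] is non-negative. *)
Lemma finite_eigenvalues_gap k : 0 < k -> k < b ->
  finite_set [set a | (exists x, eigenvector M a x) /\ 0 < (a - k) * (b - a)].
Proof.
move=> k0 kb; have [L [_ hL]] := K_small_cofinite k0.
pose G : {linear V -> V} :=
  (((k + b) \*: M) \- (M \o M)) \- ((k * b) \*: idfun).
apply: (@finite_positive_eigenvalues _ _ _ M G _ (L ++ map Q L) M_symmetric).
  move=> a x Mx; rewrite /G /= Mx [M (_ *: _)]linearZ /= Mx !scalerA.
  rewrite -scalerBl -scalerBl.
  by congr (_ *: _); ring.
move=> x /orth_cat[Lx /(orth_map Qs) LQx].
set u := Q x in LQx; pose v := x - u.
have Lv : orth ip L v by apply: orthD => //; rewrite -scaleN1r; apply: orthZ.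
have xE : x = u + v by rewrite /v addrC subrK.
have uv : '[u, v] = 0 by exact: proj_orth.
have QxE : Q x = u by [].
clearbody v u.
have Kv := form_le_of_sq_le k0 (hL v Lv).
have Ku := Kpos u.
pose w := M x.
have wE : w = K u + K v + b *: u by rewrite /w ME QxE {1}xE linearD.
have GE : '[G x, x] = (k + b) * '[w, x] - '[w] - k * b * '[x].
  by rewrite /G /= !(ipDl, ipNl, ipZl) (M_symmetric (M x)).
clearbody w G.
have wu : '[w, u] - '[w, v] = '[K u, u] - '[K v, v] + b * '[u].
  rewrite wE !(ipDl, ipZl) uv (Ks u v) (ipC ip u (K v)); ring.
have wx : '[w, x] = '[w, u] + '[w, v] by rewrite {1}xE ipDr.
have xx : '[x] = '[u] + '[v].
  by rewrite {1 2}xE !(ipDl, ipDr) (ipC ip v u) uv; ring.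
have xu : '[x, u] = '[u] by rewrite {1}xE ipDl (ipC ip v u) uv addr0.
have xv : '[x, v] = '[v] by rewrite {1}xE ipDl uv add0r.
have h0 : 0 < (b - k) / 2 by lra.
(* The square of [(M - c) x - h (u - v)] gives the bound without roots. *)
have := sq_ge0 ip (w - ((k + b) / 2) *: x - ((b - k) / 2) *: (u - v)).
rewrite !(ipDl, ipDr, ipNl, ipNr, ipZl, ipZr).
rewrite (ipC ip x w) (ipC ip u w) (ipC ip v w) (ipC ip u x) (ipC ip v x).
rewrite (ipC ip v u) uv xu xv GE wx xx.
have h1 : 0 <= (b - k) / 2 * ('[w, u] - '[w, v] - b * '[u] + k * '[v]).
  by apply: mulr_ge0; [exact: ltW|rewrite wu; lra].
lra.
Qed.

Lemma finite_eigenvalues_above k : 0 < k ->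
  finite_set [set a | (exists x, eigenvector M a x) /\ 0 < a - (b + k)].
Proof.
move=> k0; have [L [_ hL]] := K_small_cofinite k0.
pose G : {linear V -> V} := M \- ((b + k) \*: idfun).
apply: (@finite_positive_eigenvalues _ _ _ M G _ L M_symmetric).
  by move=> a x Mx; rewrite /G /= Mx -scalerBl.
move=> x Lx; rewrite /G /= ipDl ipNl ipZl ME ipDl ipZl proj_form.
have h1 := form_le_of_sq_le k0 (hL x Lx).
have h2 : b * '[Q x] <= b * '[x].
  by apply: ler_wpM2l; [exact: ltW|exact: proj_contract].
lra.
Qed.

(** It vanishes when [K = 0], since [M / b] is then a projection; in general it
    has the eigenvalue [m (m - b)] whenever [M] has the eigenvalue [m]. *)
Definition defect : {linear V -> V} := (M \o M) \- (b \*: M).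

(** In this form the operator is visibly compact. *)
Lemma defectE x : defect x = K (M x - b *: x) + b *: Q (K x).
Proof.
have QM : Q (M x) = Q (K x) + b *: Q x.
  by rewrite ME linearD linearZ /= QQ.
have bM : b *: M x = b *: K x + b *: (b *: Q x) by rewrite ME scalerDr.
rewrite /defect /= bM (ME (M x)) QM linearB [K (_ *: _)]linearZ /= [RHS]addrAC.
by rewrite scalerDr opprD (addrC (- _)) !addrA addrK.
Qed.

Lemma defect_symmetric : symmetric_op ip defect.
Proof.
move=> x y; rewrite /defect /= !(ipDl, ipDr, ipNl, ipNr, ipZl, ipZr).
by rewrite !(M_symmetric (M _)) !(M_symmetric x).
Qed.

Lemma defect_compact : compact_along ip U defect.
Proof.
move=> x [C hC].
have [CK CK0 hK] := compact_along_bounded UF Uoo cK.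
have [y2 h2] : exists y, cvg_along ip U (K \o x) y by apply: cK; exists C.
have [y1 h1] : exists y, cvg_along ip U (K \o (fun n => M (x n) - b *: x n)) y.
  apply: cK; exists ((4 * CK + 6 * b ^+ 2) * C) => n.
  have hM : '[M (x n)] <= 2 * (CK * '[x n]) + 2 * (b * (b * '[x n])).
    rewrite ME; apply: le_trans (sq_add_le _ _ _) _; rewrite ipZl ipZr lerD //.
      by rewrite ler_pM2l // hK.
    by rewrite !ler_pM2l //; exact: proj_contract.
  apply: le_trans (sq_sub_le _ _ _) _; rewrite ipZl ipZr.
  have : (4 * CK + 6 * b ^+ 2) * '[x n] <= (4 * CK + 6 * b ^+ 2) * C.
    by apply: ler_wpM2l => //; rewrite addr_ge0 // mulr_ge0 // sqr_ge0.
  lra.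
exists (y1 + b *: Q y2) => e e0.
have h3 : cvg_along ip U (fun n => b *: Q (K (x n))) (b *: Q y2).
  move=> d d0; have d1 : 0 < d / b ^+ 2 by rewrite divr_gt0 // exprn_gt0.
  apply: filterS (h2 _ d1) => n /=; rewrite ltr_pdivlMr ?exprn_gt0 // => hd.
  rewrite -scalerBr -(linearB Q) ipZl ipZr mulrA mulrC -expr2.
  by apply: le_lt_trans hd; rewrite ler_pM2r ?exprn_gt0 //; exact: proj_contract.
by apply: filterS (cvg_alongD UF h1 h3 e0) => n; rewrite /mkset /comp defectE.
Qed.

(** Off finitely many of its eigenvectors, the compact operator [M^2 - b M] is
    small.  If it is nonzero there, it has a small nonzero eigenvalue [a], and a
    root of [m^2 - b m = a] is an eigenvalue of [M].  If it is zero there, pair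
    its value at [x = u + v], where [u = Q x], with [u - v]: the square of [K u],
    plus [b] times the forms of [K] at [u] and [v], equals the square of [K v].
    On a subspace of finite codimension the latter is at most [b / 2] times the
    form at [v], so that [K] vanishes there and has finite rank. *)
Lemma small_eigenvalues (d : R) : ~ finite_rank K -> 0 < d ->
  exists a, [/\ exists x, eigenvector M a x, a != 0, a != b &
                `|a * (a - b)| < d].
Proof.
move=> Kinf d0.
(* The bound [b ^+ 2 / 8] makes the discriminant [b ^+ 2 + 4 a] positive. *)
pose k := Num.min (d / 2) (b ^+ 2 / 8).
have k0 : 0 < k by rewrite lt_min !divr_gt0 // exprn_gt0.
have kd : k <= d / 2 by rewrite ge_min lexx.
have kb : k <= b ^+ 2 / 8 by rewrite ge_min lexx orbT.
have [LD [hLD LDs]] :=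
  eigenvectors_off_small UF Uoo defect_symmetric defect_compact (exprn_gt0 2 k0).
have b2 : 0 < b / 2 by rewrite divr_gt0.
have [LK [hLK LKs]] := K_small_cofinite b2.
have [x0 Lx0 Dx0] : exists2 x, orth ip LD x & defect x != 0.
  apply: contrapT => hD; apply: Kinf.
  apply: (@finite_rank_of_orth _ _ ip _ (LD ++ LK ++ map Q LK)).
  move=> x /orth_cat[Dx /orth_cat[Lx /(orth_map Qs) LQx]].
  have {}Dx : defect x = 0.
    by apply/eqP; apply/negPn/negP => Dn; apply: hD; exists x.
  pose u := Q x; pose v := x - u.
  have Lv : orth ip LK v by apply: orthD => //; rewrite -scaleN1r; apply: orthZ.
  have xE : x = u + v by rewrite /v addrC subrK.
  have QJ : Q (u - v) = u.
    by rewrite /v /u !linearB /= !QQ subrr addr0.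
  have MJ : M x - b *: x = K x - b *: v.
    by rewrite ME /v scalerBr opprB addrA.
  clearbody v u.
  have Kv := sq_le_nonnegative_form b2 (LKs _ (orth_eigen Ks hLK Lv)).
  have Ku := Kpos u; have Kv0 := Kpos v.
  have : '[defect x, u - v] = 0 by rewrite Dx ip0l.
  have -> : '[defect x, u - v] =
     '[K u] - '[K v] + b * ('[K u, u] + '[K v, v]).
    rewrite defectE MJ (linearB K) [K (_ *: _)]linearZ /= !ipDl ipNl !ipZl.
    rewrite Qs QJ (Ks (K x)) {1 2}xE !(linearD K, linearN K) !(ipDl, ipDr, ipNr).
    rewrite (ipC ip (K v) (K u)); ring.
  move=> h; have Ku0 := sq_ge0 ip (K u); have Kv1 := sq_ge0 ip (K v).
  have bu : 0 <= b * '[K u, u] by rewrite mulr_ge0 // ltW.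
  have Kvv : b / 2 * '[K v, v] = 0.
    have : 0 <= b / 2 * '[K v, v] by rewrite mulr_ge0 // ltW.
    lra.
  have /eqP : '[K u] = 0 by lra.
  have /eqP : '[K v] = 0 by lra.
  by rewrite !sq_eq0 xE linearD => /eqP -> /eqP ->; rewrite addr0.
have [a [x [[xn Dx] Lx a2]]] : exists a x,
    [/\ eigenvector defect a x, orth ip LD x & 0 < a ^+ 2].
  apply: (exists_eigenvector UF Uoo defect_symmetric defect_compact _ (lexx 0) Lx0).
    by move=> x; exact: orth_eigen defect_symmetric hLD.
  by rewrite mul0r sq_gt0.
have ak : `|a| <= k.
  rewrite -(@ler_pXn2r _ 2) ?nnegrE ?normr_ge0 ?(ltW k0) // real_normK ?num_real //.
  have := LDs x Lx; rewrite Dx ipZl ipZr mulrA -expr2.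
  by rewrite ler_pM2r ?sq_gt0.
have disc : 0 < b ^+ 2 + 4 * a.
  have := exprn_gt0 2 b0; move: ak; rewrite ler_norml => /andP[]; lra.
pose s := Num.sqrt (b ^+ 2 + 4 * a).
have s2 : s ^+ 2 = b ^+ 2 + 4 * a by rewrite sqr_sqrtr // ltW.
have a0 : a != 0 by move: a2; apply: contraTneq => ->; rewrite expr0n ltxx.
have root_eigenvalue c : (exists x, eigenvector M c x) -> c * (c - b) = a ->
    exists a, [/\ exists x, eigenvector M a x, a != 0, a != b &
                `|a * (a - b)| < d].
  move=> hc ca; exists c; split=> //.
  - by apply: contra_neq a0 => c0; rewrite -ca c0 mul0r.
  - by apply: contra_neq a0 => cb; rewrite -ca cb subrr mulr0.
  - rewrite ca; lra.
(* [M^2 - b M - a] factors through the roots [(b - s) / 2], [(b + s) / 2]. *)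
have [w0|wn] := eqVneq (M x - ((b - s) / 2) *: x) 0.
  apply: (root_eigenvalue ((b - s) / 2)); last by lra.
  by exists x; split=> //; apply/eqP; rewrite -subr_eq0 w0.
apply: (root_eigenvalue ((b + s) / 2)); last by lra.
exists (M x - ((b - s) / 2) *: x); split=> //.
have MMx : M (M x) = b *: M x + a *: x.
  by apply/eqP; rewrite addrC -subr_eq -Dx /defect.
rewrite linearB [M (_ *: _)]linearZ /= MMx scalerBr scalerA addrAC -scalerBl.
congr (_ *: _ + _); first by field.
rewrite -scaleNr; congr (_ *: _).
have -> : a = (s ^+ 2 - b ^+ 2) / 4 by rewrite s2; field.
by field.
Qed.

End Perturbation.

(** * Symmetry of the spectrum of a combination of two projections *)

Section Reflection.
Variables (R : realType) (V : lmodType R).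
Variables (Q1 Q2 M : {linear V -> V}) (b1 b2 : R).
Hypothesis Q1Q1 : forall x, Q1 (Q1 x) = Q1 x.
Hypothesis Q2Q2 : forall x, Q2 (Q2 x) = Q2 x.
Hypothesis ME : forall x, M x = x - b1 *: Q1 x - b2 *: Q2 x.

(** Let [B = I - M = b1 Q1 + b2 Q2], [B x = l x] and [p = b1 Q1 x].  The
    idempotence of [Q2] gives [B p = (b1 + b2 - l) p + l (l - b2) x], so that
    the span of [x] and [p] is invariant under [B], on which the other eigenvalue
    is [b1 + b2 - l].  Here [y = p - c x] is its eigenvector, and [y] vanishes
    only if [c] is [0] or [b1], that is, if [l] is one of [0], [b2], [b1],
    [b1 + b2]; the last excluded value is the one where both eigenvalues
    coincide. *)
Lemma reflected_eigenvalue m x : eigenvector M m x ->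
    m \notin [:: 1; 1 - b1; 1 - b2; 1 - b1 - b2; 1 - (b1 + b2) / 2] ->
  exists y, eigenvector M (2 - b1 - b2 - m) y.
Proof.
move=> [xn Mx]; rewrite !inE !negb_or => /and5P[m1 mb1 mb2 mb3 mh].
pose l := 1 - m; pose p := b1 *: Q1 x.
have l2 : 2 * l - (b1 + b2) != 0.
  apply: contra_neq mh => h; rewrite /l in h; lra.
pose c := l * (l - b2) / (2 * l - (b1 + b2)).
have cE : c * (2 * l - (b1 + b2)) = l * (l - b2) by rewrite divfK.
have E1 : b2 *: Q2 x = l *: x - p.
  have := ME x; rewrite Mx -/p /l scalerBl scale1r => ->.
  by rewrite opprB addrCA opprB subrKC addrK.
have Q1p : Q1 p = p by rewrite /p linearZ /= Q1Q1.
have pQ : b1 *: Q1 x = p by [].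
clearbody p.
have E2 : b2 *: Q2 p = (l - b2) *: (l *: x - p).
  have : Q2 (b2 *: Q2 x) = Q2 (l *: x - p) by rewrite E1.
  rewrite linearB !linearZ /= Q2Q2 => h.
  have -> : Q2 p = (l - b2) *: Q2 x by rewrite scalerBl h subKr.
  by rewrite scalerA mulrC -scalerA E1.
have lin (k d : R) :
    p - b1 *: p - k *: (l *: x - p) - c *: (d *: x) =
    (1 - b1 + k) *: p - (k * l + c * d) *: x.
  by rewrite scalerBr !scalerA opprB !(scalerDl, scaleNr, scale1r) opprD !addrA.
have My : M (p - c *: x) = (2 - b1 - b2 - m) *: (p - c *: x).
  rewrite linearB [M (_ *: _)]linearZ /= Mx ME Q1p E2 lin scalerBr scalerA.
  congr (_ *: _ - _ *: _); first by rewrite /l; ring.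
  by rewrite mulrC -cE /l; ring.
exists (p - c *: x); split=> //; apply/eqP => /eqP; rewrite subr_eq0 => /eqP pE.
have : (b1 - c) * c == 0.
  rewrite -[_ == 0]orbF -(negPf xn) -scaler_eq0 -scalerA -pE scalerBl subr_eq0.
  by rewrite -{1}Q1p {1}pE linearZ /= scalerA mulrC -scalerA pQ pE.
rewrite mulf_eq0 subr_eq0 => /orP[] /eqP ce.
  have : (l - b1) * (l - (b1 + b2)) == 0.
    by apply/eqP; move: cE; rewrite -ce => cE; rewrite /l in cE *; lra.
  rewrite mulf_eq0 => /orP[]/eqP h; [move: mb1|move: mb3]; rewrite /l in h;
    by move/eqP; apply; lra.
move/eqP: cE; rewrite ce mul0r eq_sym mulf_eq0 => /orP[]/eqP h; rewrite /l in h.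
  by move/eqP: m1; apply; lra.
by move/eqP: mb2; apply; lra.
Qed.
End Reflection.

(** * Three projections in a real inner product space *)

Section RealMain.
Variables (R : realType) (V : lmodType R) (ip : {dot V for @idfun R}).
Local Notation "''[' u , v ]" := (ip u%R v%R) : ring_scope.
Local Notation "''[' u ]" := '[u, u] : ring_scope.

Variables (U : set_system nat) (UF : ProperFilter U).
Hypothesis Uoo : forall N, U [set n | (N <= n)%N].

Lemma finite_set_lower_bound (S : set R) (f : R -> R) : finite_set S ->
  (forall a, S a -> 0 < f a) -> exists2 d, 0 < d & forall a, S a -> d <= f a.
Proof.
move=> /finite_seqP[s ->] {S} fpos.
have {}fpos a : a \in s -> 0 < f a by move=> /fpos.
elim: s fpos => [|x s IH] fpos; first by exists 1.
case: IH => [a as_|d d0 hd]; first by apply: fpos; rewrite inE as_ orbT.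
exists (Num.min d (f x)); first by rewrite lt_min d0 fpos // mem_head.
move=> a /=; rewrite inE => /orP[/eqP ->|/hd h]; first by rewrite ge_min lexx orbT.
by rewrite ge_min h.
Qed.

(** Read with [t] equal to [r] minus [0], [b3] or [2 b3], this provides the
    precision [e] at which the sum of two eigenvalues cannot be [r]. *)
Lemma small_below_positive (t : R) : exists2 e, 0 < e & t <= 0 \/ 2 * e < t.
Proof.
have [t0|t0] := leP t 0; first by exists 1 => //; left.
by exists (t / 3); [rewrite divr_gt0|right; lra].
Qed.

(** Only finitely many eigenvalues [a] of [M] are exceptional for the symmetry,
    or lie outside the intervals of length [e] above [0] and [b3], or have such a
    reflection [r - a]; and [M] has infinitely many eigenvalues other than [0]
    and [b3].  Any remaining [a] contradicts the choice of [e]. *)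
Lemma finite_rank_of_three_projections_pos
    (K Q1 Q2 Q3 : {linear V -> V}) (b1 b2 b3 : R) :
    symmetric_op ip K -> (forall x, 0 <= '[K x, x]) -> compact_along ip U K ->
    symmetric_op ip Q3 ->
    (forall x, Q1 (Q1 x) = Q1 x) -> (forall x, Q2 (Q2 x) = Q2 x) ->
    (forall x, Q3 (Q3 x) = Q3 x) -> 0 < b3 ->
    (forall x, x - K x = b1 *: Q1 x + b2 *: Q2 x + b3 *: Q3 x) ->
  finite_rank K.
Proof.
move=> Ks Kpos cK Q3s Q1Q1 Q2Q2 Q3Q3 b0 KQ; apply: contrapT => Kinf.
pose M : {linear V -> V} := K \+ (b3 \*: Q3).
have ME x : M x = K x + b3 *: Q3 x by [].
have ME' x : M x = x - b1 *: Q1 x - b2 *: Q2 x.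
  have aux (u v w s : V) : u + v + w + s - u - v = s + w.
    by rewrite -(addrA (u + v)) -addrA -opprD (addrC (u + v)) addrK addrC.
  by have /eqP := KQ x; rewrite subr_eq => /eqP {2}->; rewrite aux.
pose E := [set a | exists x, eigenvector M a x].
pose r := 2 - b1 - b2.
have [e1 e10 he1] := small_below_positive r.
have [e2 e20 he2] := small_below_positive (r - b3).
have [e3 e30 he3] := small_below_positive (r - 2 * b3).
pose e := Num.min (Num.min e1 e2) (Num.min e3 (b3 / 2)).
have e0 : 0 < e by rewrite !lt_min e10 e20 e30 divr_gt0.
have : [/\ e <= e1, e <= e2, e <= e3 & e <= b3 / 2].
  by rewrite !ge_min !lexx !orbT.
case=> ee1 ee2 ee3 eb.
have e_lt_b : e < b3 by lra.
pose bad := [set a | E a /\ 0 < (a - e) * (b3 - a)] `|`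
            [set a | E a /\ 0 < a - (b3 + e)].
have finbad : finite_set bad.
  rewrite finite_setU; split.
    exact: (finite_eigenvalues_gap UF Uoo Ks Q3s Kpos Q3Q3 cK ME).
  exact: (finite_eigenvalues_above UF Uoo Ks Q3s Q3Q3 cK b0 ME).
have good a : E a -> ~ bad a -> 0 <= a <= e \/ b3 <= a <= b3 + e.
  move=> Ea nb; have a0 : 0 <= a.
    by have [x] := Ea; apply: (eigenvalue_ge0 Q3s Kpos Q3Q3 b0 ME).
  have [ab|ab] := ltP a b3.
    left; rewrite a0 leNgt; apply/negP => ea; apply: nb; left; split=> //.
    by rewrite mulr_gt0 // subr_gt0.
  right; apply/andP; split=> //.
  rewrite leNgt; apply/negP => ea; apply: nb; right; split=> //.
  by rewrite subr_gt0.
pose exc := [:: 1; 1 - b1; 1 - b2; 1 - b1 - b2; 1 - (b1 + b2) / 2].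
pose W := bad `|` [set` exc] `|` [set r - a | a in bad].
have finW : finite_set W.
  rewrite /W finite_setU; split; last exact: finite_image.
  by rewrite finite_setU; split=> //; exact: finite_seq.
pose E' := [set a | [/\ E a, a != 0 & a != b3]].
have [a [Ea an0 anb] nWa] : exists2 a, E' a & ~ W a.
  apply: contrapT => h.
  have EW : E' `<=` W by move=> a Ea; apply: contrapT => nW; apply: h; exists a.
  have [d d0 hd] : exists2 d, 0 < d & forall a, E' a -> d <= `|a * (a - b3)|.
    apply: finite_set_lower_bound; first exact: sub_finite_set EW finW.
    by move=> a [_ a0 ab]; rewrite normr_gt0 mulf_neq0 // subr_eq0.
  have [a [Ea a0 ab]] :=
    small_eigenvalues UF Uoo Ks Q3s Kpos Q3Q3 cK b0 ME Kinf d0.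
  by rewrite ltNge hd.
have ga : 0 <= a <= e \/ b3 <= a <= b3 + e.
  by apply: good => // ba; apply: nWa; left; left.
have [x hx] := Ea.
have [y hy] : E (r - a).
  apply: (reflected_eigenvalue Q1Q1 Q2Q2 ME' hx).
  by apply/negP => aexc; apply: nWa; left; right.
have gr : 0 <= r - a <= e \/ b3 <= r - a <= b3 + e.
  apply: good => [|ba]; first by exists y.
  by apply: nWa; right; exists (r - a) => //; rewrite subKr.
have a0 : 0 < a.
  by rewrite lt0r an0; case: ga => /andP[]//; move: b0; lra.
have ab : b3 <= a -> b3 < a by rewrite lt_def anb.
case: ga => /andP[h1 h2]; case: gr => /andP[h3 h4].
- by case: he1; lra.
- by case: he2; lra.
- by have := ab h1; case: he2; lra.
- by have := ab h1; case: he3; lra.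
Qed.

(** On a subspace of finite codimension the form of [K] is at most half the
    square of the norm, hence that subspace is zero. *)
Lemma finite_rank_of_coercive (K : {linear V -> V}) :
    symmetric_op ip K -> compact_along ip U K ->
    (forall x, '[x] <= '[K x, x]) -> finite_rank K.
Proof.
move=> Ks cK Kge.
have h0 : 0 < (1 / 2 : R) by lra.
have [L [_ hL]] := eigenvectors_off_small UF Uoo Ks cK (exprn_gt0 2 h0).
apply: (@finite_rank_of_orth _ _ ip _ L) => x Lx.
have h1 := form_le_of_sq_le h0 (hL x Lx).
have /eqP : '[x] = 0 by have := Kge x; have := sq_ge0 ip x; lra.
by rewrite sq_eq0 => /eqP ->; rewrite linear0.
Qed.

Lemma finite_rank_of_three_projections
    (K Q1 Q2 Q3 : {linear V -> V}) (b1 b2 b3 : R) :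
    symmetric_op ip K -> (forall x, 0 <= '[K x, x]) -> compact_along ip U K ->
    symmetric_op ip Q1 -> symmetric_op ip Q2 -> symmetric_op ip Q3 ->
    (forall x, Q1 (Q1 x) = Q1 x) -> (forall x, Q2 (Q2 x) = Q2 x) ->
    (forall x, Q3 (Q3 x) = Q3 x) ->
    (forall x, x - K x = b1 *: Q1 x + b2 *: Q2 x + b3 *: Q3 x) ->
  finite_rank K.
Proof.
move=> Ks Kpos cK Q1s Q2s Q3s Q1Q1 Q2Q2 Q3Q3 KQ.
have [b30|b3n] := ltP 0 b3.
  exact: (finite_rank_of_three_projections_pos Ks Kpos cK Q3s Q1Q1 Q2Q2 Q3Q3 b30 KQ).
have [b20|b2n] := ltP 0 b2.
  apply: (finite_rank_of_three_projections_pos Ks Kpos cK Q2s Q1Q1 Q3Q3 Q2Q2 b20) => x.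
  by rewrite KQ addrAC.
have [b10|b1n] := ltP 0 b1.
  apply: (finite_rank_of_three_projections_pos Ks Kpos cK Q1s Q3Q3 Q2Q2 Q1Q1 b10) => x.
  by rewrite KQ addrC addrA addrAC.
apply: finite_rank_of_coercive => // x.
have : '[x - K x, x] <= 0.
  have hQ (Q : {linear V -> V}) b : symmetric_op ip Q ->
      (forall x, Q (Q x) = Q x) -> b <= 0 -> b * '[Q x, x] <= 0.
    by move=> Qs QQ bn; rewrite (proj_form Qs QQ) mulr_le0_ge0 // sq_ge0.
  rewrite KQ !(ipDl, ipZl).
  have := hQ _ _ Q1s Q1Q1 b1n; have := hQ _ _ Q2s Q2Q2 b2n.
  have := hQ _ _ Q3s Q3Q3 b3n; lra.
by rewrite ipDl ipNl subr_le0.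
Qed.

End RealMain.

(** * The underlying real space of a complex one *)

(** A copy of [H] on which the scalars are real, so that both module structures
    can be used side by side. *)
Definition realification (R : realType) (H : lmodType R[i]) : Type := H.

Section Realification.
Variables (R : realType) (H : lmodType R[i]).
Local Notation HR := (realification H).

HB.instance Definition _ := GRing.Zmodule.copy HR H.

Definition real_scale (a : R) (x : HR) : HR := a%:C *: (x : H).

Lemma real_scaleA a b x : real_scale a (real_scale b x) = real_scale (a * b) x.
Proof. by rewrite /real_scale scalerA rmorphM. Qed.

Lemma real_scale1 : left_id 1 real_scale.
Proof. by move=> x; rewrite /real_scale rmorph1 scale1r. Qed.

Lemma real_scaleDr : right_distributive real_scale +%R.
Proof. by move=> a x y; rewrite /real_scale scalerDr. Qed.

Lemma real_scaleDl x : {morph real_scale^~ x : a b / a + b}.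
Proof. by move=> a b; rewrite /real_scale rmorphD scalerDl. Qed.

HB.instance Definition _ :=
  GRing.Zmodule_isLmodule.Build R HR
    real_scaleA real_scale1 real_scaleDr real_scaleDl.

Lemma real_scaleE (a : R) (x : HR) : a *: x = (a%:C *: (x : H) : H).
Proof. by []. Qed.

Section Operator.
Variable T : {linear H -> H}.
Definition real_op (x : HR) : HR := T x.
Lemma real_op_is_linear : linear real_op.
Proof. by move=> a x y; rewrite /real_op !real_scaleE linearD linearZ. Qed.
HB.instance Definition _ :=
  GRing.isLinear.Build R HR HR *:%R real_op real_op_is_linear.
End Operator.

Section Form.
Variable ip : {dot H for (@Num.conj R[i])}.
Definition real_ip (x y : HR) : R := complex.Re (ip x y).

Lemma Re_conj (z : R[i]) : complex.Re (Num.conj z) = complex.Re z.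
Proof. by case: z. Qed.

Lemma ReM (a : R) (z : R[i]) : complex.Re (a%:C * z) = a * complex.Re z.
Proof. by case: z => u v /=; rewrite mul0r subr0. Qed.

Lemma ReD (z w : R[i]) : complex.Re (z + w) = complex.Re z + complex.Re w.
Proof. by case: z w => [? ?] [? ?]. Qed.

Lemma real_ipC x y : real_ip x y = real_ip y x.
Proof. by rewrite /real_ip (hermC ip) expr0 mul1r Re_conj. Qed.

Lemma real_ip_bilinear : bilinear_for
  (GRing.Scale.Law.clone _ _ ( *%R ) _)
  (GRing.Scale.Law.clone _ _ (@idfun R \; *%R ) _) real_ip.
Proof.
have l (u : HR) a x y : real_ip (a *: x + y) u = a * real_ip x u + real_ip y u.
  by rewrite /real_ip real_scaleE linearDl ReD linearZl_LR ReM.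
split=> [u|u] a x y /=; first exact: l.
by rewrite real_ipC l !(real_ipC u).
Qed.

HB.instance Definition _ := bilinear_isBilinear.Build R HR HR R
  (GRing.Scale.Law.clone _ _ ( *%R ) _)
  (GRing.Scale.Law.clone _ _ (@idfun R \; *%R ) _) real_ip real_ip_bilinear.

Lemma real_ip_hermitian (x y : HR) :
  real_ip x y = (-1) ^+ false * idfun (real_ip y x).
Proof. by rewrite expr0 mul1r real_ipC. Qed.

HB.instance Definition _ :=
  isHermitianSesquilinear.Build R HR false idfun real_ip real_ip_hermitian.

Lemma real_ip_gt0 (x : HR) : x != 0 -> 0 < real_ip x x.
Proof.
move=> xn; have : 0 < ip x x by exact: neq0_dnorm_gt0.
by rewrite ltcE => /andP[_].
Qed.

HB.instance Definition _ := isDotProduct.Build R HR real_ip real_ip_gt0.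

Definition real_dot : {dot HR for @idfun R} := real_ip.
End Form.
End Realification.

Section Transfer.
Variables (R : realType) (H : completeNormedModType R[i]).
Variables (ip : {dot H for (@Num.conj R[i])}) (hip : norm_from_inner ip).

Lemma norm_real_ip (x : H) : `|x| = (Num.sqrt (real_ip ip x x))%:C.
Proof.
have x2 := hip x.
have ipx : ip x x = (real_ip ip x x)%:C.
  have : 0 <= ip x x by rewrite -x2 exprn_ge0.
  by rewrite /real_ip; case: (ip x x) => u v; rewrite lecE /= => /andP[/eqP ->].
have r0 : 0 <= real_ip ip x x.
  by have := exprn_ge0 2 (normr_ge0 x); rewrite x2 ipx lecR.
apply/eqP; rewrite -(@eqrXn2 _ 2) ?normr_ge0 ?lecR ?sqrtr_ge0 //.
by rewrite x2 ipx -rmorphXn /= sqr_sqrtr.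
Qed.

(** The images along [G] have a cluster point in a compact set; [G] being an
    ultrafilter, they converge to it. *)
Lemma compact_operator_along (G : set_system nat) (T : {linear H -> H}) :
  UltraFilter G -> compact_operator T ->
  compact_along (real_dot ip) G (real_op T).
Proof.
move=> GU cT x [M hM].
have bx : bounded_set (range x).
  exists (Num.sqrt M)%:C; split; first by apply: ger0_real; rewrite lecR sqrtr_ge0.
  move=> N MN _ [n _ <-]; apply: le_trans (ltW MN).
  by rewrite norm_real_ip lecR ler_wsqrtr // hM.
have [B TB [cB _]] := cT _ bx.
pose F : set_system H := (fun n => T (x n)) @ G.
have FB : F B.
  apply: (@filterS _ G _ setT) filterT => n _.
  by apply: TB; exists (x n) => //; exists n.
have [y [_ yF]] := cB F _ FB.
exists y => e e0.
have [//|nG] := in_ultra_setVsetC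
  [set n | real_dot ip (T (x n) - y) (T (x n) - y) < e] GU.
pose C : set H := [set z | ~ (real_ip ip (z - y) (z - y) < e)].
have FC : F C by [].
have ny : nbhs y [set z : H | real_ip ip (z - y) (z - y) < e].
  apply/nbhs_normP; exists (Num.sqrt e)%:C => /=; first by rewrite ltcR sqrtr_gt0.
  by move=> z /=; rewrite distrC norm_real_ip ltcR ltr_sqrt.
by have [z [Cz ez]] := yF _ _ FC ny.
Qed.

Lemma finite_rank_range (T : {linear H -> H}) :
  finite_rank (real_op T) -> finite_dimensional (range T).
Proof.
case=> s hs; exists (size s), (fun i => T s`_i).
apply/seteqP; split=> [_ [x _ <-]|_ [c _ <-]].
  by have [c hc] := hs x; exists (fun i => (c i)%:C).
exists (\sum_(i < size s) c i *: s`_i) => //.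
by rewrite linear_sum; apply: eq_bigr => i _; rewrite linearZ.
Qed.

Lemma self_adjoint_real_op (T : {linear H -> H}) : self_adjoint ip T ->
  symmetric_op (real_dot ip) (real_op T).
Proof. by move=> Ts x y; rewrite /real_dot /= /real_ip /real_op Ts. Qed.

End Transfer.

Theorem proposition4p2 (R : realType) (H : completeNormedModType R[i])
    (ip : {dot H for (@Num.conj R[i])}) (hip : norm_from_inner ip)
    (hsep : separable H) (hdim : ~ finite_dimensional [set: H])
    (K : {linear H -> H}) (hKsa : self_adjoint ip K)
    (hKnn : nonnegative_operator ip K) (hKcomp : compact_operator K)
    (hKrank : infinite_rank K) :
  ~ exists (b1 b2 b3 : R) (Q1 Q2 Q3 : {linear H -> H}),
      [/\ orthoprojection ip Q1, orthoprojection ip Q2, orthoprojection ip Q3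
        & forall x : H,
            x - K x = b1%:C *: Q1 x + b2%:C *: Q2 x + b3%:C *: Q3 x].
Proof.
move=> [b1 [b2 [b3 [Q1 [Q2 [Q3 [[_ s1 p1] [_ s2 p2] [_ s3 p3] KQ]]]]]]].
(* [G] is a free ultrafilter, along which all limits are taken. *)
have [G [GU Goo]] := ultraFilterLemma eventually_filter.
apply: hKrank; apply: finite_rank_range.
have GP := @ultra_proper _ _ GU.
apply: (@finite_rank_of_three_projections _ _ (real_dot ip) G GP _
  (real_op K) (real_op Q1) (real_op Q2) (real_op Q3) b1 b2 b3);
  try exact: self_adjoint_real_op.
- by move=> N; apply: Goo; exists N.
- by move=> x; have := hKnn x; rewrite lecE => /andP[].
- exact: compact_operator_along.
- exact: p1.
- exact: p2.
- exact: p3.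
- exact: KQ.
Qed.
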